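(* Let $\mathbf M=(M,+,\cdot,\vec 0)$ be a semimodule over a commutative semiring $(S,\oplus,\cdot,0,1)$ with a fixed basis $(\vec b_i)_{i\in I}$. Then $\mathbf L(\mathbf M)=(L(\mathbf M),+,\cap,{}^\perp,\{\vec 0\},M)$ is a complete lattice with an antitone unary operation $^\perp$, and $\mathbf L_c(\mathbf M)=(L_c(\mathbf M),\vee,\cap,{}^\perp,\{\vec 0\},M)$ is a complete lattice with an antitone involution $^\perp$.
   Context: A commutative semiring is an algebra $(S,\oplus,\cdot,0,1)$ such that $(S,\oplus,0)$ and $(S,\cdot,1)$ are commutative monoids, $(x\oplus y)z=xz\oplus yz$ and $x0=0$ for all $x,y,z\in S$. A semimodule over it is $(M,+,\cdot,\vec 0)$ with $\cdot:S\times M\to M$ such that $(M,+,\vec 0)$ is a commutative monoid and for all $\vec x,\vec y\in M$, $a,b\in S$: $a(\vec x+\vec y)=a\vec x+a\vec y$, $(a\oplus b)\vec x=a\vec x+b\vec x$, $(ab)\vec x=a(b\vec x)$, $1\vec x=\vec x$, $0\vec x=a\vec 0=\vec 0$. Basis: a family $(\vec b_i)_{i\in I}$ of elements of $M$, $I$ a non-empty set, such that for every $\vec x\in M$ there is exactly one function $f:I\to S$ with $f(i)=0$ for all but finitely many $i$ and $\sum_{i\in I}f(i)\vec b_i=\vec x$; the coordinates of $\vec x$ are $x_i:=f(i)$. The inner product is $\vec x\vec y:=\sum_{i\in I}x_iy_i\in S$ (sum with respect to $\oplus$). Write $\vec x\perp\vec y$ if $\vec x\vec y=0$, and for $C\subseteq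 M$ put $C^\perp:=\{\vec x\in M\mid\vec x\perp\vec y\text{ for all }\vec y\in C\}$. A subsemimodule is a subset $U\subseteq M$ containing $\vec 0$ and closed under $+$ and under multiplication by elements of $S$. $L(\mathbf M)$ is the set of all subsemimodules; $L_c(\mathbf M)$ is the set of all closed ones, i.e. those with $U^{\perp\perp}=U$. Both are ordered by inclusion. For subsemimodules, $U+W:=\{\vec x+\vec y\mid\vec x\in U,\vec y\in W\}$, $\sum_{j\in J}U_j$ is the set of sums of finitely many elements of $\bigcup_{j\in J}U_j$, $U\vee W:=(U+W)^{\perp\perp}$ and $\bigvee_{j\in J}U_j:=(\sum_{j\in J}U_j)^{\perp\perp}$. In $\mathbf L(\mathbf M)$ joins are $+$ (resp. $\sum$), in $\mathbf L_c(\mathbf M)$ joins are $\vee$ (resp. $\bigvee$), and meets in both are intersections. Antitone: $U\subseteq W$ implies $W^\perp\subseteq U^\perp$; an involution additionally satisfies $U^{\perp\perp}=U$. *)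

(* Defs.v *)
From mathcomp Require Import all_boot all_order all_algebra.
From mathcomp Require Import all_classical.

Set Implicit Arguments.
Unset Strict Implicit.
Unset Printing Implicit Defensive.
Import GRing.Theory.

Local Open Scope classical_set_scope.
Local Open Scope ring_scope.

(* The semiring may be trivial (0 = 1), hence comPzSemiRingType rather than
   comNzSemiRingType. *)

(* The finite-support condition is needed next to the sum: \sum_(i \in A) takes
   the value 0 on terms with infinite support. *)
Definition lin_comb (S : comPzSemiRingType) (M : lSemiModType S)
    (I : choiceType) (b : I -> M) (x : M) (f : I -> S) : Prop :=
  finite_set [set i | f i <> 0] /\ \sum_(i \in [set: I]) f i *: b i = x.

Definition is_basis (S : comPzSemiRingType) (M : lSemiModType S)
    (I : choiceType) (b : I -> M) : Prop :=
  [set: I] !=set0 /\ forall x : M, exists! f : I -> S, lin_comb b x f.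

(* When b is a basis this is the unique f with lin_comb b x f; the default
   value 0 is then never used. *)
Definition coord (S : comPzSemiRingType) (M : lSemiModType S)
    (I : choiceType) (b : I -> M) (x : M) : I -> S :=
  xget (fun=> 0) [set f | lin_comb b x f].

Definition inner (S : comPzSemiRingType) (M : lSemiModType S)
    (I : choiceType) (b : I -> M) (x y : M) : S :=
  \sum_(i \in [set: I]) coord b x i * coord b y i.

Definition orth (S : comPzSemiRingType) (M : lSemiModType S)
    (I : choiceType) (b : I -> M) (C : set M) : set M :=
  [set x | forall y, C y -> inner b x y = 0].

Definition subsemimodules (S : comPzSemiRingType) (M : lSemiModType S) :
    set (set M) :=
  [set U | [/\ U 0, forall x y, U x -> U y -> U (x + y)
             & forall (a : S) x, U x -> U (a *: x)]].
Arguments subsemimodules {S} M _.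

Definition closed_subsemimodules (S : comPzSemiRingType) (M : lSemiModType S)
    (I : choiceType) (b : I -> M) : set (set M) :=
  [set U | subsemimodules M U /\ orth b (orth b U) = U].

Definition sum_sub (S : comPzSemiRingType) (M : lSemiModType S)
    (U W : set M) : set M :=
  [set x + y | x in U & y in W].

Definition bigsum_sub (S : comPzSemiRingType) (M : lSemiModType S)
    (J : Type) (U : J -> set M) : set M :=
  [set \sum_(x <- s) x |
    s in [set s : seq M | forall x, x \in s -> (\bigcup_j U j) x]].

Definition join_closed (S : comPzSemiRingType) (M : lSemiModType S)
    (I : choiceType) (b : I -> M) (U W : set M) : set M :=
  orth b (orth b (sum_sub U W)).

Definition bigjoin_closed (S : comPzSemiRingType) (M : lSemiModType S)
    (I : choiceType) (b : I -> M) (J : Type) (U : J -> set M) : set M :=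
  orth b (orth b (bigsum_sub U)).

(* Ordered structures are carried by a subset L of an ambient type T.  The
   operations are defined on all of T and required to map L into L: this is the
   membership clause of is_lub and is_glb. *)
Definition is_lub (T : Type) (L : set T) (le : T -> T -> Prop) (A : set T)
    (s : T) : Prop :=
  [/\ L s, forall x, A x -> le x s
    & forall u, L u -> (forall x, A x -> le x u) -> le s u].

Definition is_glb (T : Type) (L : set T) (le : T -> T -> Prop) (A : set T)
    (s : T) : Prop :=
  [/\ L s, forall x, A x -> le s x
    & forall u, L u -> (forall x, A x -> le u x) -> le u s].

Record complete_lattice (T : Type) (L : set T) (le : T -> T -> Prop)
    (join meet : T -> T -> T) (bigjoin bigmeet : forall J : Type, (J -> T) -> T)
    (bot top : T) : Prop := CompleteLattice {
  cl_refl : forall x, L x -> le x x;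
  cl_antisym : forall x y, L x -> L y -> le x y -> le y x -> x = y;
  cl_trans : forall x y z, L x -> L y -> L z -> le x y -> le y z -> le x z;
  cl_join : forall x y, L x -> L y -> is_lub L le [set x; y] (join x y);
  cl_meet : forall x y, L x -> L y -> is_glb L le [set x; y] (meet x y);
  cl_bigjoin : forall (J : Type) (U : J -> T), (forall j, L (U j)) ->
    is_lub L le (range U) (bigjoin J U);
  cl_bigmeet : forall (J : Type) (U : J -> T), (forall j, L (U j)) ->
    is_glb L le (range U) (bigmeet J U);
  cl_bot : L bot /\ forall x, L x -> le bot x;
  cl_top : L top /\ forall x, L x -> le x top
}.

Definition antitone_operation (T : Type) (L : set T) (le : T -> T -> Prop)
    (op : T -> T) : Prop :=
  (forall x, L x -> L (op x)) /\
  (forall x y, L x -> L y -> le x y -> le (op y) (op x)).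

Definition antitone_involution (T : Type) (L : set T) (le : T -> T -> Prop)
    (op : T -> T) : Prop :=
  antitone_operation L le op /\ forall x, L x -> op (op x) = x.

(* Main.v *)
Require Import Defs.
From mathcomp Require Import all_boot all_order all_algebra.
From mathcomp Require Import finmap all_classical.

Import Defs GRing.Theory.
Local Open Scope classical_set_scope.
Local Open Scope ring_scope.

(**
The inner product is bilinear and, since the coordinates of [b i] are the
Kronecker delta at [i], the elements [b i] recover the coordinates of a vector;
hence it is nondegenerate. The map [orth] is therefore an antitone Galois
connection whose values are subsemimodules, and [U |-> orth (orth U)] is a
closure operator fixing [{0}] and [M]. Suprema of closed subsemimodules are the
closures of the suprema taken among all subsemimodules, while infima are the
same in both posets.
*)

Section InnerProduct.
Context {S : comPzSemiRingType} {M : lSemiModType S} {I : choiceType}.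
Context {b : I -> M}.

(** Terms outside [A] vanish, so the sum over all of [I] collapses to an ordinary finite one, and
    finiteness of the support is automatic. [A] may exceed the support, which lets several vectors
    share one index set. *)
Lemma lin_comb_fset {A : {fset I}} {f : I -> S} (x : M) :
  (forall i, i \notin A -> f i = 0) ->
  lin_comb b x f <-> \sum_(i <- A) f i *: b i = x.
Proof.
move=> f0; have f0b i : i \notin A -> f i *: b i = 0.
  by move=> /f0 ->; rewrite scale0r.
rewrite /lin_comb (@fsbigTE _ _ _ _ A _ f0b); split=> [[]//|]; split=> //.
apply: (@sub_finite_set _ _ [set` A]) => // i /= fi.
by apply/negP => /negP /f0.
Qed.

Context (hb : is_basis b).

Lemma coordP (x : M) : lin_comb b x (coord b x).
Proof. by have [f [fx _]] := hb.2 x; exact: xgetI fx. Qed.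

(** The way coordinates get computed below: it suffices to exhibit one finitely supported
    combination with value [x]. *)
Lemma coord_unique (x : M) (f : I -> S) : lin_comb b x f -> coord b x = f.
Proof.
by have [g [_ gu]] := hb.2 x => fx; rewrite -(gu _ (coordP x)) -(gu _ fx).
Qed.

Lemma coord_support (x : M) :
  exists A : {fset I}, forall i, i \notin A -> coord b x i = 0.
Proof.
have [fin _] := coordP x; exists (fset_set [set i | coord b x i <> 0]) => i.
by rewrite in_fset_set // => /negP; rewrite inE /= => /contrapT.
Qed.

Lemma coordD (x y : M) : coord b (x + y) = fun i => coord b x i + coord b y i.
Proof.
(* The union of the two supports serves as common index set for [x], [y] and [x + y]. *)
have [A Ax] := coord_support x; have [B By] := coord_support y.
have {}Ax i : i \notin (A `|` B)%fset -> coord b x i = 0.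
  by rewrite inE negb_or => /andP[/Ax].
have {}By i : i \notin (A `|` B)%fset -> coord b y i = 0.
  by rewrite inE negb_or => /andP[_ /By].
apply: coord_unique; apply/(lin_comb_fset (A := (A `|` B)%fset)) => [i iAB|].
  by rewrite Ax ?By ?addr0.
under eq_bigr do rewrite scalerDl.
rewrite big_split /=; congr (_ + _).
- exact/(lin_comb_fset _ Ax)/coordP.
- exact/(lin_comb_fset _ By)/coordP.
Qed.

Lemma coordZ (a : S) (x : M) : coord b (a *: x) = fun i => a * coord b x i.
Proof.
have [A Ax] := coord_support x.
apply: coord_unique; apply/(lin_comb_fset (A := A)) => [i /Ax ->|].
  by rewrite mulr0.
under eq_bigr do rewrite -scalerA.
by rewrite -scaler_sumr; congr (_ *: _); exact/(lin_comb_fset _ Ax)/coordP.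
Qed.

Lemma coord_basis (i : I) : coord b (b i) = fun j => (j == i)%:R.
Proof.
apply: coord_unique; apply/(lin_comb_fset (A := [fset i]%fset)) => [j|].
  by rewrite inE => /negbTE ->.
by rewrite big_seq_fset1 eqxx scale1r.
Qed.

(** The factor from [x] alone kills the terms outside [A]. One index set thus works for every second
    argument, so linearity in that argument becomes a statement about finite sums. *)
Lemma inner_fset {A : {fset I}} {x : M} (y : M) :
  (forall i, i \notin A -> coord b x i = 0) ->
  inner b x y = \sum_(i <- A) coord b x i * coord b y i.
Proof. by move=> Ax; apply: fsbigTE => i /Ax ->; rewrite mul0r. Qed.

Lemma innerC (x y : M) : inner b x y = inner b y x.
Proof. by apply: eq_fsbigr => i _; rewrite mulrC. Qed.

Lemma inner_addr (x y z : M) : inner b x (y + z) = inner b x y + inner b x z.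
Proof.
have [A Ax] := coord_support x.
rewrite !(inner_fset _ Ax) -big_split; apply: eq_bigr => i _.
by rewrite coordD mulrDr.
Qed.

Lemma inner_scaler (a : S) (x y : M) : inner b x (a *: y) = a * inner b x y.
Proof.
have [A Ax] := coord_support x.
rewrite !(inner_fset _ Ax) big_distrr; apply: eq_bigr => i _.
by rewrite coordZ mulrCA.
Qed.

Lemma inner0r (x : M) : inner b x 0 = 0.
Proof. by rewrite -(scale0r (0 : M)) inner_scaler mul0r. Qed.

Lemma inner_basis (i : I) (x : M) : inner b (b i) x = coord b x i.
Proof.
rewrite (inner_fset (A := [fset i]%fset)) => [|j].
  by rewrite big_seq_fset1 coord_basis eqxx mul1r.
by rewrite coord_basis inE => /negbTE ->.
Qed.

(** Testing against the basis elements shows that every coordinate of [x] is zero, and [x] is the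
    combination of the basis with these coordinates. *)
Lemma inner_nondegenerate (x : M) : (forall y, inner b x y = 0) -> x = 0.
Proof.
move=> x0; have cx0 i : coord b x i = 0 by rewrite -inner_basis innerC x0.
have [_ <-] := coordP x; apply: fsbig1 => i _.
by rewrite cx0 scale0r.
Qed.

Lemma orth_subsemimodule (C : set M) : subsemimodules M (orth b C).
Proof.
(* Symmetry moves the vector under test to the right, where linearity is available. *)
split=> [y _|x y xC yC z zC|a x xC z zC]; rewrite innerC.
- exact: inner0r.
- by rewrite inner_addr -!(innerC _ z) !(xC, yC) ?addr0 //.
- by rewrite inner_scaler innerC xC ?mulr0.
Qed.

Lemma orth_antitone (C D : set M) : C `<=` D -> orth b D `<=` orth b C.
Proof. by move=> CD x xD y /CD /xD. Qed.

Lemma subset_orthK (C : set M) : C `<=` orth b (orth b C).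
Proof. by move=> x Cx y yC; rewrite innerC; exact: yC. Qed.

(** The usual Galois identity: one inclusion is [subset_orthK] at [orth b C], the other is [orth]
    applied to [subset_orthK] at [C]. *)
Lemma orth_closed (C : set M) : closed_subsemimodules b (orth b C).
Proof.
split; first exact: orth_subsemimodule.
apply/seteqP; split; last exact: subset_orthK.
exact/orth_antitone/subset_orthK.
Qed.

Lemma orthT : orth b setT = [set 0].
Proof.
apply/seteqP; split=> [x x0 /=|_ -> y _]; last by rewrite innerC inner0r.
by apply: inner_nondegenerate => y; exact: x0.
Qed.

Lemma orth0 : orth b [set 0] = setT.
Proof. by apply/seteqP; split=> // x _ _ ->; exact: inner0r. Qed.

(** A closed upper bound [V] of [A] contains [U], hence its double orthogonal, which is [V] itself,
    contains that of [U]. *)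
Lemma is_lub_orthK (A : set (set M)) (U : set M) :
  is_lub (subsemimodules M) (@subset M) A U ->
  is_lub (closed_subsemimodules b) (@subset M) A (orth b (orth b U)).
Proof.
case=> _ ubU leU; split=> [|V AV|V [subV clV] ubV].
- exact: orth_closed.
- exact: subset_trans (ubU _ AV) (subset_orthK U).
- by rewrite -clV; do 2 apply: orth_antitone; exact: leU.
Qed.

(** The point is that [U] is closed: its double orthogonal lies in that of each member of [A], hence
    in the member itself, so it is a lower bound of [A] and is contained in [U]. *)
Lemma is_glb_closed (A : set (set M)) (U : set M) :
  A `<=` closed_subsemimodules b ->
  is_glb (subsemimodules M) (@subset M) A U ->
  is_glb (closed_subsemimodules b) (@subset M) A U.
Proof.
move=> clA [subU lbU geU]; split=> // [|V [subV _]]; last exact: geU.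
split=> //; apply/seteqP; split; last exact: subset_orthK.
apply: geU => [|V AV]; first exact: orth_subsemimodule.
by have [_ <-] := clA _ AV; do 2 apply: orth_antitone; exact: lbU.
Qed.

End InnerProduct.

Section Subsemimodules.
Context {S : comPzSemiRingType} {M : lSemiModType S}.

Lemma subsemimodule_sum (U : set M) (s : seq M) : subsemimodules M U ->
  (forall x, x \in s -> U x) -> U (\sum_(x <- s) x).
Proof.
by move=> [U0 UD _] Us; rewrite big_seq; apply: (big_ind U).
Qed.

Lemma sum_sub_lub (U W : set M) : subsemimodules M U -> subsemimodules M W ->
  is_lub (subsemimodules M) (@subset M) [set U; W] (sum_sub U W).
Proof.
move=> [U0 UD UZ] [W0 WD WZ]; split=> [|_ [] -> x|V [_ VD _] ubV].
- split.
  + by exists 0 => //; exists 0; rewrite ?addr0.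
  + move=> _ _ [x Ux [y Wy <-]] [x' Ux' [y' Wy' <-]].
    by exists (x + x'); [exact: UD|exists (y + y'); [exact: WD|rewrite addrACA]].
  + move=> a _ [x Ux [y Wy <-]].
    by exists (a *: x); [exact: UZ|exists (a *: y); [exact: WZ|rewrite scalerDr]].
- by exists x => //; exists 0; rewrite ?addr0.
- by exists 0 => //; exists x; rewrite ?add0r.
- move=> _ [x Ux [y Wy <-]].
  by apply: VD; [apply: (ubV U)|apply: (ubV W)] => //; [left|right].
Qed.

Lemma bigsum_sub_lub (J : Type) (U : J -> set M) :
  (forall j, subsemimodules M (U j)) ->
  is_lub (subsemimodules M) (@subset M) (range U) (bigsum_sub U).
Proof.
move=> subU; split=> [|_ [j _ <-] x Ux|V subV ubV].
- split.
  (* The empty list supplies 0 even when [J] is empty. *)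
  + by exists [::] => //; rewrite big_nil.
  + move=> _ _ [s Us <-] [t Ut <-]; exists (s ++ t); last by rewrite big_cat.
    by move=> x; rewrite mem_cat => /orP[/Us|/Ut].
  + move=> a _ [s Us <-].
    exists (map (fun x => a *: x) s); last by rewrite big_map scaler_sumr.
    move=> _ /mapP[x /Us [j _ Ux] ->]; exists j => //.
    by have [_ _] := subU j; exact.
- exists [:: x]; last by rewrite big_seq1.
  by move=> y; rewrite inE => /eqP ->; exists j.
- move=> _ [s Us <-]; apply: subsemimodule_sum => // x /Us [j _].
  by apply: ubV; exists j.
Qed.

Lemma bigcap_glb (J : Type) (U : J -> set M) :
  (forall j, subsemimodules M (U j)) ->
  is_glb (subsemimodules M) (@subset M) (range U) (\bigcap_j U j).
Proof.
move=> subU; split=> [|_ [j _ <-] x|V _ lbV x Vx j _]; last 2 first.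
- exact.
- by apply: lbV Vx; exists j.
split=> [j _|x y Ux Uy j _|a x Ux j _]; have [U0 UD UZ] := subU j => //.
- by apply: UD; [exact: Ux|exact: Uy].
- by apply: UZ; exact: Ux.
Qed.

Lemma setI_glb (U W : set M) : subsemimodules M U -> subsemimodules M W ->
  is_glb (subsemimodules M) (@subset M) [set U; W] (U `&` W).
Proof.
move=> [U0 UD UZ] [W0 WD WZ]; split=> [|_ [] -> x []//|V _ lbV x Vx].
- split=> // [x y [Ux Wx] [Uy Wy]|a x [Ux Wx]].
  + by split; [exact: UD|exact: WD].
  + by split; [exact: UZ|exact: WZ].
- by split; [apply: (lbV U)|apply: (lbV W)] => //; [left|right].
Qed.

Lemma subsemimodule0 : subsemimodules M [set 0].
Proof. by split=> // [_ _ -> ->|a _ ->]; rewrite /= ?addr0 ?scaler0. Qed.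

End Subsemimodules.

Theorem theorem2p8 (S : comPzSemiRingType) (M : lSemiModType S)
    (I : choiceType) (b : I -> M) (hb : is_basis b) :
  (complete_lattice (subsemimodules M) (@subset M)
     (@sum_sub S M) (@setI M)
     (@bigsum_sub S M) (fun (J : Type) (U : J -> set M) => \bigcap_j U j)
     [set 0] [set: M] /\
   antitone_operation (subsemimodules M) (@subset M) (orth b)) /\
  (complete_lattice (closed_subsemimodules b) (@subset M)
     (join_closed b) (@setI M)
     (@bigjoin_closed S M I b) (fun (J : Type) (U : J -> set M) => \bigcap_j U j)
     [set 0] [set: M] /\
   antitone_involution (closed_subsemimodules b) (@subset M) (orth b)).
Proof.
have sub0 U : subsemimodules M U -> [set 0] `<=` U by move=> [U0 _ _] x ->.
split; split.
- split=> //.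
  + by move=> U _ x.
  + by move=> U W _ _ UW WU; apply/seteqP; exact: conj.
  + by move=> U V W _ _ _; exact: subset_trans.
  + exact: sum_sub_lub.
  + exact: setI_glb.
  + exact: bigsum_sub_lub.
  + exact: bigcap_glb.
  + by split; [exact: subsemimodule0|].
- by split=> [U _|U W _ _]; [exact: orth_subsemimodule|exact: orth_antitone].
- split=> //.
  + by move=> U _ x.
  + by move=> U W _ _ UW WU; apply/seteqP; exact: conj.
  + by move=> U V W _ _ _; exact: subset_trans.
  + by move=> U W [? _] [? _]; apply: is_lub_orthK => //; exact: sum_sub_lub.
  + move=> U W clU clW; apply: is_glb_closed => //; first by move=> _ [] ->.
    by apply: setI_glb; [case: clU|case: clW].
  + move=> J U clU; apply: is_lub_orthK => //; apply: bigsum_sub_lub => j.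
    by case: (clU j).
  + move=> J U clU; apply: is_glb_closed => //; first by move=> _ [j _ <-].
    by apply: bigcap_glb => j; case: (clU j).
  (* The two bounds are closed because each is the orthogonal of the other. *)
  + by split=> [|U [/sub0]//]; rewrite -(orthT hb); exact: orth_closed.
  + by split=> //; rewrite -(orth0 hb); exact: orth_closed.
(* The involution law is the second clause of [closed_subsemimodules]. *)
- split=> [|U []//].
  by split=> [U _|U W _ _]; [exact: orth_closed|exact: orth_antitone].
Qed.
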